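(* Let $I=\prod_{i=1}^n[0,\rho_i]$ (each $[0,\rho_i]$ a closed nonempty interval), let $\lambda_i,\eta_i$ ($i=1,\dots,n$) be real parameters, and let $P_I=\{u\in C(\overline{\Omega},\mathbb{R}^n_+): u(x)\in I \text{ for all } x\in\overline{\Omega}\}$. Assume that for every $i=1,\dots,n$: (1) $f_i\in C(\overline\Omega\times I)$ and there exists $\tau_i\in(0,+\infty)$ such that $$0\le f_i(x,u)\le\tau_iu_i\quad\text{for every }(x,u)\in\overline\Omega\times I;$$ (2) $h_i:P_I\to[0,+\infty)$ is continuous and there exists $\xi_i\in(0,+\infty)$ such that $$h_i[u]\le\xi_i\|u\|\quad\text{for every }u\in P_I;$$ (3) the following inequality holds: $$\lambda_i\tau_i\|K_i(1)\|_\infty+\eta_i\xi_i\|\gamma_i\|_\infty<1 .$$ Then the system $$L_iu_i(x)=\lambda_if_i(x,u(x)),\ x\in\Omega,\qquad B_iu_i(x)=\eta_ih_i[u],\ x\in\partial\Omega,\qquad i=1,\dots,n,$$ has at most the zero solution in $P_I$.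
   Context: Domain. $\Omega\subset\mathbb{R}^m$, $m\ge2$, is a bounded domain whose boundary $\partial\Omega$ is an $(m-1)$-dimensional $C^{2+\hat\mu}$-manifold for some $\hat\mu\in(0,1)$, such that $\Omega$ lies locally on one side of $\partial\Omega$. $n\ge1$ is an integer. Operators $L_i$. For $i=1,\dots,n$, $$L_iu(x)=-\sum_{j,l=1}^m a_{ijl}(x)\frac{\partial^2u}{\partial x_j\partial x_l}(x)+\sum_{j=1}^m a_{ij}(x)\frac{\partial u}{\partial x_j}(x)+a_i(x)u(x),\quad x\in\Omega,$$ where $a_{ijl},a_{ij},a_i\in C^{\hat\mu}(\overline\Omega)$, $a_i\ge0$ on $\overline\Omega$, $a_{ijl}=a_{ilj}$ on $\overline\Omega$ for $j,l=1,\dots,m$, and $L_i$ is strongly uniformly elliptic: there exists $\bar\mu_{i0}>0$ with $\sum_{j,l=1}^m a_{ijl}(x)\xi_j\xi_l\ge\bar\mu_{i0}\|\xi\|^2$ for all $x\in\Omega$, $\xi\in\mathbb{R}^m$. Boundary operators $B_i$. For $i=1,\dots,n$, $$B_iu(x)=b_i(x)u(x)+\delta_i\frac{\partial u}{\partial\nu}(x),\quad x\in\partial\Omega,$$ where $\nu$ is an outward pointing, nowhere tangent vector field on $\partial\Omega$ of class $C^{1+\hat\mu}$ (not necessarily unit), $\partial u/\partial\nu$ is the directional derivative with respect to $\nu$, $b_i:\partial\Omega\to\mathbb{R}$ is of class $C^{1+\hat\mu}$, and one of the following holds: (Dirichlet) $\delta_i=0$ and $b_i\equiv1$; (Neumann)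 $\delta_i=1$, $b_i\equiv0$ and $a_i\not\equiv0$; (regular oblique derivative) $\delta_i=1$, $b_i\ge0$ and $b_i\not\equiv0$. Solution operators. For $g\in C^{\hat\mu}(\overline\Omega)$ the problem $L_iu=g$ in $\Omega$, $B_iu=0$ on $\partial\Omega$ has a unique classical solution $u\in C^{2+\hat\mu}(\overline\Omega)$, denoted $K_ig$. The linear operator $K_i$ extends uniquely to a continuous, linear, compact operator $K_i:C(\overline\Omega)\to C(\overline\Omega)$, denoted by the same symbol; it maps non-negative functions to non-negative functions. $K_i(1)$ is the image of the constant function $1$. $\gamma_i\in C^{2+\hat\mu}(\overline\Omega)$ is the unique (non-negative) solution of $L_iu=0$ in $\Omega$, $B_iu=1$ on $\partial\Omega$. Norms and notation. $\|z\|_\infty=\max_{x\in\overline\Omega}|z(x)|$ for $z\in C(\overline\Omega)$; $\|u\|=\max_{i=1,\dots,n}\|u_i\|_\infty$ for $u=(u_1,\dots,u_n)\in C(\overline\Omega,\mathbb{R}^n)$; $\mathbb{R}_+=[0,+\infty)$. Continuity of $h_i$ is with respect to the norm $\|\cdot\|$. For $u\in C(\overline\Omega,I)$, $F_i(u)(x):=f_i(x,u(x))$. Weak solution. A function $u\in C(\overline\Omega,I)$ is a weak solution of the system if $u_i=\lambda_iK_iF_i(u)+\eta_ih_i[u]\gamma_i$ for every $i=1,\dots,n$. ''Solution'' in the claim means weak solution.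
   Formalization: The formal theorem adds the assumption that λ_iη_i ≥ 0 for every i; for real parameters of opposite signs the claim fails, e.g. n=1, f=0, λ=−1, h[u]=ξ‖u‖, ηξ‖γ‖=1, where small positive multiples of γ are nonzero solutions. *)

(* Defs.v *)
From HB Require Import structures.
From mathcomp Require Import all_boot all_order all_algebra.
From mathcomp Require Import all_classical all_reals all_analysis.

Set Implicit Arguments.
Unset Strict Implicit.
Unset Printing Implicit Defensive.

Import Order.TTheory GRing.Theory Num.Theory.
Import numFieldNormedType.Exports.

Local Open Scope classical_set_scope.
Local Open Scope ring_scope.

(** A function on the closure (or the boundary) of a domain [O] is represented
    by a total function on ['rV[R]_m] of which only the values on [closure O]
    (or on the boundary) matter: equalities and inequalities between such
    functions are always stated pointwise on that set. *)

Section FunctionSpaces.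
Context {R : realType} {m : nat}.
Local Notation V := 'rV[R]_m.
Implicit Types (O D : set V) (mu : R).

Definition boundary O : set V := closure O `\` interior O.

Definition basis_vec (j : 'I_m) : V := delta_mx 0 j.

Definition partial (j : 'I_m) (u : V -> R) (x : V) : R := 'D_(basis_vec j) u x.

(* The norm of ['rV[R]_m] is the max norm; being equivalent to the Euclidean
   one, it defines the same Hoelder functions. *)
Definition holder mu D (g : V -> R) : Prop :=
  exists C : R, forall x y, D x -> D y -> `|g x - g y| <= C * `|x - y| `^ mu.

(** [Ckmu k mu O u]: [u] is of class C^(k + mu) on [closure O], for [O] open:
    its partial derivatives of order at most [k] exist in [O] and extend
    continuously to [closure O], and the extensions of those of order [k] are
    [mu]-Hoelder on [closure O]. *)
Fixpoint Ckmu (k : nat) mu O (u : V -> R) : Prop :=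
  {within closure O, continuous u} /\
  match k with
  | 0%N => holder mu (closure O) u
  | k'.+1 => forall j : 'I_m, exists2 uj : V -> R,
      (forall x, O x -> is_derive x (basis_vec j) u (uj x)) & Ckmu k' mu O uj
  end.

(** [psi] is a C^(k + mu) defining function of [O] in the open set [U]:
    [O] is [psi < 0] and its boundary is the regular level set [psi = 0]. *)
Definition defining_function k mu O (U : set V) (psi : V -> R) : Prop :=
  [/\ open U, Ckmu k mu U psi,
      forall x, U x -> exists j, partial j psi x != 0,
      forall x, U x -> (O x <-> psi x < 0)
    & forall x, U x -> (boundary O x <-> psi x = 0)].

(** Bounded domain whose boundary is a hypersurface of class C^(2 + mu), the
    domain lying locally on one side of it. *)
Definition smooth_bounded_domain mu O : Prop :=
  [/\ O !=set0, open O, connected O, bounded_set O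
    & forall x0, boundary O x0 ->
        exists U psi, U x0 /\ defining_function 2 mu O U psi].

(** Class C^(1 + mu) on the boundary: local extendability to a function of
    class C^(1 + mu) on a neighbourhood. *)
Definition boundary_C1mu mu O (b : V -> R) : Prop :=
  forall x0, boundary O x0 -> exists U bU,
    [/\ open U, U x0, Ckmu 1 mu U bU &
        forall x, U x -> boundary O x -> b x = bU x].

(** Vector fields of class C^(1 + mu) on the boundary that are outward pointing
    and nowhere tangent.  The tangent space at [x0] is the kernel of the
    differential of [psi], and [psi] increases when leaving [O]. *)
Definition outward_field mu O (nu : V -> V) : Prop :=
  (forall j : 'I_m, boundary_C1mu mu O (fun x => nu x 0 j)) /\
  (forall x0, boundary O x0 -> exists U psi,
    [/\ U x0, defining_function 2 mu O U psi &
        0 < \sum_(j < m) nu x0 0 j * partial j psi x0]).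

Definition C0 O : set (V -> R) := [set g | {within closure O, continuous g}].

Definition supnorm O (z : V -> R) : R := sup [set `|z x| | x in closure O].

End FunctionSpaces.

Section EllipticProblems.
Context {R : realType} {m : nat}.
Local Notation V := 'rV[R]_m.
Implicit Types (O : set V) (mu : R) (nu : V -> V).

Record diff_op := DiffOp {
  coef2 : 'I_m -> 'I_m -> V -> R;
  coef1 : 'I_m -> V -> R;
  coef0 : V -> R }.

Definition apply_op (L : diff_op) (u : V -> R) (x : V) : R :=
  - (\sum_(j < m) \sum_(l < m) coef2 L j l x * partial j (partial l u) x)
  + \sum_(j < m) coef1 L j x * partial j u x + coef0 L x * u x.

Definition elliptic_op mu O (L : diff_op) : Prop :=
  [/\ [/\ forall j l, Ckmu 0 mu O (coef2 L j l),
          forall j, Ckmu 0 mu O (coef1 L j) & Ckmu 0 mu O (coef0 L)],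
      forall x, closure O x -> 0 <= coef0 L x,
      forall j l x, closure O x -> coef2 L j l x = coef2 L l j x
    & exists2 mu0 : R, 0 < mu0 & forall x (zeta : V), O x ->
        mu0 * \sum_(j < m) zeta 0 j ^+ 2
        <= \sum_(j < m) \sum_(l < m) coef2 L j l x * zeta 0 j * zeta 0 l].

Record bdry_op := BdryOp { bcoef : V -> R; bdelta : R }.

(** First order derivatives of a function of class C^1 on [closure O] are
    extended by continuity to the boundary. *)
Definition bdry_derive O (u : V -> R) (v x : V) : R :=
  \sum_(j < m) v 0 j * lim (partial j u y @[y --> within O (nbhs x)]).

Definition apply_bdry O nu (B : bdry_op) (u : V -> R) (x : V) : R :=
  bcoef B x * u x + bdelta B * bdry_derive O u (nu x) x.

Definition dirichlet O (B : bdry_op) : Prop :=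
  bdelta B = 0 /\ forall x, boundary O x -> bcoef B x = 1.

Definition neumann O (L : diff_op) (B : bdry_op) : Prop :=
  [/\ bdelta B = 1, forall x, boundary O x -> bcoef B x = 0
    & exists2 x, closure O x & coef0 L x != 0].

Definition regular_oblique O (B : bdry_op) : Prop :=
  [/\ bdelta B = 1, forall x, boundary O x -> 0 <= bcoef B x
    & exists2 x, boundary O x & bcoef B x != 0].

Definition admissible_bdry_op mu O (L : diff_op) (B : bdry_op) : Prop :=
  boundary_C1mu mu O (bcoef B) /\
  [\/ dirichlet O B, neumann O L B | regular_oblique O B].

Definition classical_solution mu O nu (L : diff_op) (B : bdry_op)
    (g phi u : V -> R) : Prop :=
  [/\ Ckmu 2 mu O u, forall x, O x -> apply_op L u x = g x
    & forall x, boundary O x -> apply_bdry O nu B u x = phi x].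

(** Compactness of an operator on the space of continuous functions on
    [closure O]: images of bounded sequences have uniformly convergent
    subsequences. *)
Definition compact_operator O (K : (V -> R) -> V -> R) : Prop :=
  forall (g : nat -> V -> R) (M : R),
    (forall k, C0 O (g k)) -> (forall k, supnorm O (g k) <= M) ->
    exists s : nat -> nat, exists z : V -> R,
      [/\ {homo s : a b / (a < b)%N}, C0 O z &
          supnorm O (K (g (s k)) \- z) @[k --> \oo] --> (0 : R)].

(** [K] is the compact, continuous, linear extension to the continuous
    functions on [closure O] of the operator that maps [g] of class C^mu to the
    unique classical solution of [L u = g], [B u = 0]; it preserves
    non-negativity. *)
Record solution_operator mu O nu (L : diff_op) (B : bdry_op)
    (K : (V -> R) -> V -> R) : Prop := {
  solop_C0 : forall g, C0 O g -> C0 O (K g);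
  solop_solves : forall g, Ckmu 0 mu O g ->
    classical_solution mu O nu L B g (cst 0) (K g);
  solop_unique : forall g u, Ckmu 0 mu O g ->
    classical_solution mu O nu L B g (cst 0) u ->
    forall x, closure O x -> u x = K g x;
  solop_linear : forall (a : R) g1 g2, C0 O g1 -> C0 O g2 ->
    forall x, closure O x ->
      K (fun y => a * g1 y + g2 y) x = a * K g1 x + K g2 x;
  solop_continuous : forall g, C0 O g -> forall e : R, 0 < e ->
    exists2 d : R, 0 < d & forall g', C0 O g' ->
      supnorm O (g' \- g) < d -> supnorm O (K g' \- K g) < e;
  solop_compact : compact_operator O K;
  solop_ge0 : forall g, C0 O g -> (forall x, closure O x -> 0 <= g x) ->
    forall x, closure O x -> 0 <= K g x }.

(** The non-negative solution of [L u = 0], [B u = 1]; its uniqueness follows,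
    by linearity, from [solop_unique]. *)
Definition boundary_solution mu O nu (L : diff_op) (B : bdry_op)
    (gamma : V -> R) : Prop :=
  classical_solution mu O nu L B (cst 0) (cst 1) gamma /\
  forall x, closure O x -> 0 <= gamma x.

End EllipticProblems.

Arguments diff_op : clear implicits.
Arguments bdry_op : clear implicits.

Section Systems.
Context {R : realType} {m n : nat}.
Local Notation V := 'rV[R]_m.
Local Notation W := 'rV[R]_n.
Implicit Types (O : set V) (rho : 'I_n -> R) (u : V -> W).

Definition component u (i : 'I_n) : V -> R := fun x => u x 0 i.

Definition box rho : set W := [set w | forall i, 0 <= w 0 i <= rho i].

Definition P_I O rho : set (V -> W) :=
  [set u | {within closure O, continuous u} /\
           forall x, closure O x -> box rho (u x)].

(* The start value 0 of the iterated maximum is harmless since norms are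
   non-negative. *)
Definition sysnorm O u : R := \big[Num.max/0]_(i < n) supnorm O (component u i).

Definition continuous_on_P_I O rho (h : (V -> W) -> R) : Prop :=
  forall u, P_I O rho u -> forall e : R, 0 < e ->
    exists2 d : R, 0 < d & forall v, P_I O rho v ->
      sysnorm O (v \- u) < d -> `|h v - h u| < e.

Definition superposition (f : V -> W -> R) u : V -> R := fun x => f x (u x).

Definition weak_solution O rho (K : 'I_n -> (V -> R) -> V -> R)
    (gamma : 'I_n -> V -> R) (lambda eta : 'I_n -> R)
    (f : 'I_n -> V -> W -> R) (h : 'I_n -> (V -> W) -> R) u : Prop :=
  P_I O rho u /\
  forall i x, closure O x ->
    component u i x = lambda i * K i (superposition (f i) u) x
                 + eta i * h i u * gamma i x.

End Systems.

(* Main.v *)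
(** If [s = ||u||] were positive, monotonicity of the positive operators [K_i]
    and the growth bounds on [f_i] and [h_i] would give
    [u_i <= (lambda_i tau_i ||K_i 1|| + eta_i xi_i ||gamma_i||) s] for each
    component with [lambda_i, eta_i >= 0], so that every [||u_i|| < s], against
    [s = max_i ||u_i||].  When [lambda_i, eta_i <= 0], the fixed point equation
    exhibits the non-negative function [u_i] as non-positive. *)

Require Import Defs.
From mathcomp Require Import all_boot all_order all_algebra.
From mathcomp Require Import all_classical all_reals all_analysis.
Import Order.TTheory GRing.Theory Num.Theory.
Import numFieldNormedType.Exports.
Local Open Scope classical_set_scope.
Local Open Scope ring_scope.

Set Implicit Arguments.
Unset Strict Implicit.

(** A closed ball that contains [O] also contains its closure, so Heine-Borel applies. *)
Lemma closure_bounded_compact (R : realType) (m : nat) (O : set 'rV[R]_m) :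
  (0 < m)%N -> bounded_set O -> compact (closure O).
Proof.
case: m O => // m O _ bO; apply: bounded_closed_compact; last exact: closed_closure.
have [M [_ /(_ (M + 1))]] := bO.
rewrite ltrDl ltr01 => /(_ isT) OM; exists (M + 1); split; first exact: num_real.
move=> N MN x Ox; apply: le_trans (ltW MN).
have cM : closed [set y : 'rV[R]_m.+1 | `|y| <= M + 1].
  apply: (@closed_comp _ _ (@Num.norm _ 'rV[R]_m.+1) [set r | r <= M + 1]).
    by move=> y _; exact: norm_continuous.
  exact: closed_le.
have : closure O `<=` [set y : 'rV[R]_m.+1 | `|y| <= M + 1].
  by rewrite ((closure_id _).1 cM); apply: closure_subset.
exact.
Qed.

(** Compactness makes the set of values bounded; without this, [sup] could be a default value that
    bounds nothing. *)
Lemma le_supnorm (R : realType) (m : nat) (O : set 'rV[R]_m) (z : 'rV[R]_m -> R) x :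
  compact (closure O) -> C0 O z -> closure O x -> `|z x| <= supnorm O z.
Proof.
move=> cO cz Ox.
have [M [_ /(_ (M + 1))]] := compact_bounded (continuous_compact cz cO).
rewrite ltrDl ltr01 => /(_ isT) zM.
apply: ub_le_sup; last by exists x.
by exists (M + 1) => _ [y Oy <-]; apply: zM; exists y.
Qed.

(** Non-emptiness rules out a negative [M]: over the empty set the bound is vacuous while [sup] is
    0. *)
Lemma supnorm_le (R : realType) (m : nat) (O : set 'rV[R]_m) (z : 'rV[R]_m -> R) M :
  O !=set0 -> (forall x, closure O x -> `|z x| <= M) -> supnorm O z <= M.
Proof.
move=> [x Ox] zM; apply: ge_sup; first by exists `|z x|, x => //; exact: subset_closure.
by move=> _ [y Oy <-]; exact: zM.
Qed.

Lemma component_C0 (R : realType) (m n : nat) (O : set 'rV[R]_m) (rho : 'I_n -> R) u i :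
  P_I O rho u -> C0 O (component u i).
Proof.
move=> [/subspace_continuousP cu _]; apply/subspace_continuousP => x Ox.
by apply: (cvg_comp u (fun w => w 0 i) (cu _ Ox)); exact: coord_continuous.
Qed.

Lemma superposition_C0 (R : realType) (m n : nat) (O : set 'rV[R]_m)
    (rho : 'I_n -> R) (f : 'rV[R]_m -> 'rV[R]_n -> R) u :
  {within closure O `*` box rho,
    continuous (fun p : 'rV[R]_m * 'rV[R]_n => f p.1 p.2)} ->
  P_I O rho u -> C0 O (superposition f u).
Proof.
move=> /subspace_continuousP cf [/subspace_continuousP cu bu].
apply/subspace_continuousP => x Ox.
have cp : (y, u y) @[y --> within (closure O) (nbhs x)] --> (x, u x).
  exact: (cvg_pair (f := id) (cvg_within _) (cu x Ox)).
apply: (cvg_comp (fun y => (y, u y)) (fun p => f p.1 p.2) _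
  (cf (x, u x) (conj Ox (bu x Ox)))) => A /= nA.
(* Since [f] is continuous only relative to the product of [closure O] and [box rho], the pairs
   [(y, u y)] must be kept in that set; [bu] does this. *)
have := cp _ nA; rewrite /= !nbhs_simpl /within /= => nA'.
near=> y => Oy; apply: (near nA' y) => //.
by split=> //; exact: bu.
Unshelve. all: by end_near.
Qed.

(** Positivity of [K] is applied to 1 - g/M, which fits the shape [a * g1 + g2] of [solop_linear]
    with a = -1/M. *)
Lemma solop_le_cst (R : realType) (m : nat) (mu : R) (O : set 'rV[R]_m) nu L B K
    (g : 'rV[R]_m -> R) (M : R) :
  solution_operator mu O nu L B K -> C0 O g -> 0 < M ->
  (forall x, closure O x -> g x <= M) ->
  forall x, closure O x -> K g x <= M * K (cst 1) x.
Proof.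
move=> hK cg M0 gM x Ox.
have c1 : C0 O (cst 1 : 'rV[R]_m -> R) by move=> y; exact: cst_continuous.
have cG : C0 O (fun y => - M^-1 * g y + cst 1 y).
  apply/subspace_continuousP => y Oy.
  apply: cvgD; last exact: cvg_cst.
  by apply: cvgM; [exact: cvg_cst | move/subspace_continuousP: cg; apply].
have G0 y : closure O y -> 0 <= - M^-1 * g y + cst 1 y.
  move=> Oy; rewrite mulNr addrC subr_ge0 mulrC ler_pdivrMr // mul1r; exact: gM.
have := solop_ge0 hK cG G0 Ox.
by rewrite (solop_linear hK _ cg c1 Ox) mulNr addrC subr_ge0 mulrC ler_pdivrMr // mulrC.
Qed.

Theorem theorem2p7 (R : realType) (m n : nat) (hm : (2 <= m)%N) (hn : (1 <= n)%N)
  (mu : R) (hmu : 0 < mu < 1)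
  (Omega : set 'rV[R]_m) (hOmega : smooth_bounded_domain mu Omega)
  (nu : 'rV[R]_m -> 'rV[R]_m) (hnu : outward_field mu Omega nu)
  (L : 'I_n -> diff_op R m) (hL : forall i, elliptic_op mu Omega (L i))
  (B : 'I_n -> bdry_op R m)
  (hB : forall i, admissible_bdry_op mu Omega (L i) (B i))
  (K : 'I_n -> ('rV[R]_m -> R) -> 'rV[R]_m -> R)
  (hK : forall i, solution_operator mu Omega nu (L i) (B i) (K i))
  (gamma : 'I_n -> 'rV[R]_m -> R)
  (hgamma : forall i, boundary_solution mu Omega nu (L i) (B i) (gamma i))
  (rho : 'I_n -> R) (hrho : forall i, 0 <= rho i)
  (lambda eta : 'I_n -> R) (hsign : forall i, 0 <= lambda i * eta i)
  (f : 'I_n -> 'rV[R]_m -> 'rV[R]_n -> R) (tau : 'I_n -> R)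
  (f_cont : forall i, {within closure Omega `*` box rho,
     continuous (fun p : 'rV[R]_m * 'rV[R]_n => f i p.1 p.2)})
  (tau_gt0 : forall i, 0 < tau i)
  (f_bound : forall i x w, closure Omega x -> box rho w ->
     0 <= f i x w <= tau i * w 0 i)
  (h : 'I_n -> ('rV[R]_m -> 'rV[R]_n) -> R) (xi : 'I_n -> R)
  (h_ge0 : forall i u, P_I Omega rho u -> 0 <= h i u)
  (h_cont : forall i, continuous_on_P_I Omega rho (h i))
  (xi_gt0 : forall i, 0 < xi i)
  (h_bound : forall i u, P_I Omega rho u -> h i u <= xi i * sysnorm Omega u)
  (h_small : forall i,
     lambda i * tau i * supnorm Omega (K i (cst 1))
     + eta i * xi i * supnorm Omega (gamma i) < 1) :
  forall u, weak_solution Omega rho K gamma lambda eta f h u ->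
    forall i x, closure Omega x -> u x 0 i = 0.
Proof.
move=> u [uP ueq].
have [ne0 _ _ bO _] := hOmega.
have cO : compact (closure Omega).
  by apply: closure_bounded_compact bO; exact: ltnW hm.
set s := sysnorm Omega u.
have u_le i x : closure Omega x -> u x 0 i <= s.
  move=> Ox; apply: le_trans (ler_norm _) _.
  apply: le_trans (le_supnorm cO (component_C0 uP) Ox) _.
  exact: (le_bigmax _ (fun i => supnorm Omega (component u i))).
have u_ge0 i x : closure Omega x -> 0 <= u x 0 i.
  by move=> Ox; have /andP[] := uP.2 x Ox i.
suff s0 : s <= 0.
  move=> i x Ox; apply/eqP; rewrite eq_le u_ge0 // andbT.
  exact: le_trans (u_le i x Ox) s0.
rewrite leNgt; apply/negP => s_gt0.
suff : s < s by rewrite ltxx.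
(* The maximum starts from 0, so the strict bound also requires [0 < s], which is [s_gt0]. *)
rewrite {1}/s /sysnorm; apply: bigmax_lt => // i _.
have F0 x : closure Omega x -> 0 <= superposition (f i) u x <= tau i * s.
  move=> Ox; have /andP[-> fle] := f_bound i x (u x) Ox (uP.2 x Ox).
  by apply: le_trans fle _; rewrite ler_wpM2l ?u_le // ltW.
have cF := superposition_C0 (f_cont i) uP.
have KF0 x : closure Omega x -> 0 <= K i (superposition (f i) u) x.
  by apply: (solop_ge0 (hK i) cF) => y /F0/andP[].
have [[[cgam _] _ _] gam0] := hgamma i.
(* [hsign] excludes opposite strict signs; when [lambda i] vanishes, the sign of [eta i] selects the
   case. *)
have [[lam0 eta0] | [lam0 eta0]] :
    (0 <= lambda i /\ 0 <= eta i) \/ (lambda i <= 0 /\ eta i <= 0).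
- have := hsign i; case: (ltrgt0P (lambda i)) => [l0|l0|_ _].
  + by rewrite pmulr_rge0 // => e0; left; split.
  + by rewrite nmulr_rge0 // => e0; right; split.
  + by case: (lerP 0 (eta i)) => e0; [left | right]; split=> //; exact: ltW.
- apply: (@le_lt_trans _ _ ((lambda i * tau i * supnorm Omega (K i (cst 1))
      + eta i * xi i * supnorm Omega (gamma i)) * s)); last first.
    by rewrite gtr_pMl.
  apply: supnorm_le => // x Ox; rewrite ger0_norm; last exact: u_ge0.
  rewrite ueq // mulrDl lerD //.
  + rewrite -!mulrA ler_wpM2l //.
    (* The constant dominating the superposition is [tau i * s], positive because [s] is. *)
    apply: le_trans (solop_le_cst (hK i) cF (mulr_gt0 (tau_gt0 i) s_gt0) _ Ox) _.
      by move=> y /F0/andP[].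
    rewrite -mulrA ler_wpM2l ?(ltW (tau_gt0 i)) // mulrC ler_wpM2r ?(ltW s_gt0) //.
    apply: le_trans (ler_norm _) _; apply: le_supnorm Ox => //.
    by apply: solop_C0 (hK i) _ _ => y; exact: cst_continuous.
  (* The factors are regrouped to compare [h i u] with [xi i * s] and [gamma i x] with its sup
     norm. *)
  + rewrite -!mulrA ler_wpM2l // mulrA [_ * s]mulrC mulrA [s * _]mulrC ler_pM //.
    * exact: h_ge0.
    * exact: gam0.
    * exact: h_bound.
    * by apply: le_trans (ler_norm _) _; exact: le_supnorm.
(* Both terms are now non-positive, so the sup norm of the component is at most 0, hence below
   [s]. *)
- apply: le_lt_trans s_gt0; apply: supnorm_le => // x Ox.
  rewrite ger0_norm; last exact: u_ge0.
  rewrite ueq // -[0]addr0 lerD //.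
  + by rewrite mulr_le0_ge0 // KF0.
  + by rewrite mulr_le0_ge0 ?gam0 // mulr_le0_ge0 // h_ge0.
Qed.
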